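(* Let $\mathcal{P}$ be any set of probability distributions on $\mathbb{N}=\{0,1,2,\ldots\}$, let $\mathcal{P}^\infty$ be the corresponding class of i.i.d. laws on loss sequences, and let $\Pi_0\in\mathbb{R}^+$. Then $\mathcal{P}^\infty$ is insurable (by an insurer with initial capital $\Pi_0$) if and only if no $p\in\mathcal{P}$ is deceptive.
   Context: Losses $X_1,X_2,\ldots\in\mathbb{N}$. $\mathcal{P}^\infty$ is the set of i.i.d. measures on $\mathbb{N}^\infty$ whose one-dimensional marginals form $\mathcal{P}$. $\mathbb{N}^*$ is the set of finite sequences over $\mathbb{N}$ (including the empty one), $x^n=x_1,\ldots,x_n$, and $\mathbb{R}^+$ is the set of nonnegative reals. An insurance scheme is a pair $(\tau,\Pi)$ with $\tau:\mathbb{N}^*\to\{0,1\}$ such that $\tau(x_1,\ldots,x_n)=1\Rightarrow\tau(x_1,\ldots,x_{n+1})=1$ for all $x^n$ and $p(\sup_n\tau(X^n)=1)=1$ for every $p\in\mathcal{P}^\infty$, and $\Pi:\mathbb{N}^*\to\mathbb{R}^+$ with $\Pi(x^n)=0$ whenever $\tau(x^n)=0$. The scheme goes bankrupt if $\Pi_0+\sum_{i=1}^n(\Pi(X^{i-1})-X_i)\mathbf{1}(\tau(X^{i-1})=1)<0$ for some $n\ge1$. $\mathcal{P}^\infty$ is insurable by an insurer with initial capital $\Pi_0$ if for every $\eta>0$ there is an insurance scheme $(\tau,\Pi)$ with $p((\tau,\Pi)\text{ goes bankrupt})<\eta$ for all $p\in\mathcal{P}^\infty$. For distributions $p,q$ on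 $\mathbb{N}$, $D(p\|q)=\sum_y p(y)\log_2\frac{p(y)}{q(y)}$ and $\mathrm{dist}(p,q):=D(p\|\frac{p+q}{2})+D(q\|\frac{p+q}{2})$. The (non-standard) cumulative distribution function $F_p:\mathbb{R}^+\cup\{\infty\}\to[0,1]$ is defined as the usual CDF $F_p(y)=p(\{0,\ldots,y\})$ at points $y$ of the support of $p$, by linear interpolation between consecutive support points, and $F_p(\infty)=1$; $F_p^{-1}:[0,1]\to\mathbb{R}^+\cup\{\infty\}$ is its inverse, with $F_p^{-1}(x)=0$ for $0\le x<F_p(0)$, $F_p^{-1}(1)=\infty$ if $p$ has infinite support, and otherwise $F_p^{-1}(1)$ the smallest natural number $y$ with $F_p(y)=1$. A distribution $p\in\mathcal{P}$ is deceptive if for every $\epsilon>0$ there exists $\delta>0$ such that for every real number $f$ there exists $q\in\mathcal{P}$ with $\mathrm{dist}(p,q)<\epsilon$ and $F_q^{-1}(1-\delta)>f$. *)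

(* Defs.v *)
From HB Require Import structures.
From mathcomp Require Import all_boot all_order all_algebra.
From mathcomp Require Import all_classical all_reals all_analysis.
Set Implicit Arguments. Unset Strict Implicit. Unset Printing Implicit Defensive.
Import Order.TTheory GRing.Theory Num.Theory numFieldNormedType.Exports.
Local Open Scope classical_set_scope.
Local Open Scope ring_scope.

Section Defs.
Variable R : realType.

Definition is_distr (p : nat -> R) : Prop :=
  (forall n, 0 <= p n) /\ (series p n @[n --> \oo] --> (1 : R)).

(* p^oo( (X_1,...,X_n) in A ) = sum over x^n in A of prod p(x_i) *)
Definition prob_n (p : nat -> R) (n : nat) (A : seq nat -> Prop) : \bar R :=
  \esum_(s in [set s : seq nat | size s = n /\ A s]) (\prod_(x <- s) p x)%:E.

(* Probability of the union over n of the cylinder events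
   {X^n in A n}, for an increasing family of such events
   (continuity from below of p^oo). *)
Definition prob_incr_union (p : nat -> R) (A : nat -> seq nat -> Prop) : \bar R :=
  ereal_sup (range (fun n => prob_n p n (A n))).

Definition insurance_scheme (P : set (nat -> R))
    (tau : seq nat -> bool) (Pi : seq nat -> R) : Prop :=
  (forall s x, tau s -> tau (rcons s x)) /\
  (forall p, P p -> prob_incr_union p (fun _ s => tau s) = 1%E) /\
  (forall s, 0 <= Pi s) /\
  (forall s, ~~ tau s -> Pi s = 0).

Definition capital (Pi0 : R) (tau : seq nat -> bool) (Pi : seq nat -> R)
    (s : seq nat) (m : nat) : R :=
  Pi0 + \sum_(i < m) (Pi (take i s) - (nth 0%N s i)%:R) * (tau (take i s))%:R.

Definition bankrupt_by (Pi0 : R) (tau : seq nat -> bool) (Pi : seq nat -> R)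
    (n : nat) (s : seq nat) : Prop :=
  exists m : nat, (1 <= m <= n)%N /\ capital Pi0 tau Pi s m < 0.

Definition bankrupt_prob (p : nat -> R) (Pi0 : R)
    (tau : seq nat -> bool) (Pi : seq nat -> R) : \bar R :=
  prob_incr_union p (bankrupt_by Pi0 tau Pi).

Definition insurable (P : set (nat -> R)) (Pi0 : R) : Prop :=
  forall eta : R, 0 < eta ->
    exists (tau : seq nat -> bool) (Pi : seq nat -> R),
      insurance_scheme P tau Pi /\
      forall p, P p -> (bankrupt_prob p Pi0 tau Pi < eta%:E)%E.

Definition log2 (x : R) : R := ln x / ln 2.

(* D(p||q) = sum_y p(y) log2 (p(y)/q(y)), with 0 log 0 = 0 (ln 0 = 0 here) *)
Definition KL (p q : nat -> R) : R :=
  limn (series (fun y => p y * log2 (p y / q y))).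

Definition dist (p q : nat -> R) : R :=
  let m := fun y => (p y + q y) / 2 in KL p m + KL q m.

Definition cdf (p : nat -> R) (y : nat) : R := \sum_(i < y.+1) p i.

Definition node (p : nat -> R) (n : nat) : bool := (n == 0%N) || (0 < p n).

Definition prev_node (p : nat -> R) (z : R) : nat :=
  (\max_(n < (Num.truncn z).+1 | node p n) n)%N.

(* F_p(z): linear interpolation of the CDF between consecutive nodes;
   equal to 1 beyond the largest support point. *)
Definition Fp (p : nat -> R) (z : R) : R :=
  let a := prev_node p z in
  match pselect (exists n, ((Num.truncn z < n)%N && (0 < p n))) with
  | left H =>
      let b := ex_minn H in
      cdf p a + (z - a%:R) / (b%:R - a%:R) * (cdf p b - cdf p a)
  | right _ => cdf p a
  end.

(* F_p^{-1}(x) = inf { z >= 0 | F_p(z) >= x } in R U {+oo}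
   (= +oo when the set is empty, i.e. x = 1 and p has infinite support). *)
Definition Finv (p : nat -> R) (x : R) : \bar R :=
  ereal_inf [set z%:E | z in [set z : R | 0 <= z /\ x <= Fp p z]].

Definition deceptive (P : set (nat -> R)) (p : nat -> R) : Prop :=
  forall eps : R, 0 < eps ->
    exists2 delta : R, 0 < delta &
      forall f : R, exists q, P q /\ dist p q < eps /\
        (f%:E < Finv q (1 - delta))%E.

End Defs.

(* Main.v *)
Require Import Defs.
From HB Require Import structures.
From mathcomp Require Import all_boot all_order all_algebra.
From mathcomp Require Import all_classical all_reals all_analysis.
From mathcomp Require Import ring lra.
Set Implicit Arguments. Unset Strict Implicit. Unset Printing Implicit Defensive.
Import Order.TTheory GRing.Theory Num.Theory numFieldNormedType.Exports.
Local Open Scope classical_set_scope.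
Local Open Scope ring_scope.

(** Up to constants, [p] is not deceptive iff the laws of [P] in some [dist]-ball around [p] form a
    tight family.

    If every [p] has such a ball, the insurer runs for each [k], at a time [T k], a test with
    resolution [1/(k+1)]: it enters when the laws of [P] within this resolution of the empirical
    law, on the symbols [0..k], form a tight family. By Chebyshev's inequality and a suitable
    choice of [T k], the true law fails to be among them with probability at most
    [eta / 2^(k+3)], uniformly in the law; hence every test of high resolution is passed almost
    surely, and after entering, a tail quantile of level [eta / 2^(i+3)], common to the tight
    family, is a safe premium at time [i].

    Conversely, let [p] be deceptive and fix [n] such that the scheme has entered by time [n]
    with high [p]-probability; this persists for the laws close to [p]. Some [a > 0] is such that
    laws close to [p] can have mass [a] beyond every bound, whereas mass [2 a] is impossible
    beyond some [B]. On the words over [0..B] of bounded length the premiums are bounded, and for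
    a suitable law close to [p] the first loss exceeding [B] ruins the insurer with probability
    about 1/2. *)

(* The plain name refers to the distribution function of a random variable. *)
Local Notation cdf := Defs.cdf.

(** * Expectations over words of i.i.d. letters *)

Section Expectation.
Context {R : realType}.
Local Open Scope ereal_scope.

(** The first letter is summed outermost, so that estimates follow by conditioning on it; [prob_nE]
    identifies the result with [prob_n]. *)
Fixpoint expect (p : nat -> R) (n : nat) (g : seq nat -> \bar R) : \bar R :=
  if n is m.+1 then
    \sum_(x <oo) (p x)%:E * expect p m (fun s => g (x :: s))
  else g [::].

Definition ind (A : Prop) : \bar R := (asbool A)%:R%:E.

Lemma ind_ge0 A : 0 <= ind A. Proof. by rewrite lee_fin. Qed.

Lemma ind_le1 A : ind A <= 1.
Proof. by rewrite lee_fin lern1 leq_b1. Qed.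

Lemma indT (A : Prop) : A -> ind A = 1.
Proof. by move=> h; rewrite /ind asboolT. Qed.

Lemma indF (A : Prop) : ~ A -> ind A = 0.
Proof. by move=> h; rewrite /ind asboolF. Qed.

Lemma le_ind (A B : Prop) : (A -> B) -> ind A <= ind B.
Proof.
move=> AB; case: (pselect A) => hA; last by rewrite (indF hA) ind_ge0.
by rewrite (indT hA) (indT (AB hA)).
Qed.

Variable p : nat -> R.
Hypothesis p_ge0 : forall x, (0 <= p x)%R.

Lemma eq_expect n g h : (forall s, size s = n -> g s = h s) ->
  expect p n g = expect p n h.
Proof.
elim: n g h => [|n IH] g h gh /=; first exact: gh.
by apply: eq_eseriesr => x _; congr (_ * _); apply: IH => s sn; rewrite gh//= sn.
Qed.

Lemma expect_ge0 n g : (forall s, 0 <= g s) -> 0 <= expect p n g.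
Proof.
elim: n g => [|n IH] g g0 /=; first exact: g0.
by apply: nneseries_ge0 => x _ _; rewrite mule_ge0 ?lee_fin ?p_ge0 ?IH.
Qed.

Lemma le_expect n g h : (forall s, 0 <= g s) ->
  (forall s, size s = n -> g s <= h s) -> expect p n g <= expect p n h.
Proof.
elim: n g h => [|n IH] g h g0 gh /=; first exact: gh.
apply: lee_nneseries => [x _ _|x _].
  by rewrite mule_ge0 ?lee_fin ?p_ge0// expect_ge0.
by rewrite lee_wpmul2l ?lee_fin ?p_ge0// IH// => s sn; rewrite gh//= sn.
Qed.

Lemma expectD n g h : (forall s, 0 <= g s) -> (forall s, 0 <= h s) ->
  expect p n (fun s => g s + h s) = expect p n g + expect p n h.
Proof.
elim: n g h => [|n IH] g h g0 h0 //=.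
rewrite -nneseriesD; last 2 first.
- by move=> x _ _; rewrite mule_ge0 ?lee_fin ?p_ge0// expect_ge0.
- by move=> x _ _; rewrite mule_ge0 ?lee_fin ?p_ge0// expect_ge0.
by apply: eq_eseriesr => x _; rewrite IH// ge0_muleDr// expect_ge0.
Qed.

Lemma expectZ n c g : (0 <= c)%R -> (forall s, 0 <= g s) ->
  expect p n (fun s => c%:E * g s) = c%:E * expect p n g.
Proof.
move=> c0; elim: n g => [|n IH] g g0 //=.
rewrite -nneseriesZl; last first.
  by move=> x _; rewrite mule_ge0 ?lee_fin ?p_ge0// expect_ge0.
by apply: eq_eseriesr => x _; rewrite IH// muleCA.
Qed.

Lemma expect0 n : expect p n (fun=> 0) = 0.
Proof.
elim: n => [//|n IH] /=; rewrite eseries0// => x _ _.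
by rewrite IH mule0.
Qed.

Lemma expect_sum n (r : seq nat) (g : nat -> seq nat -> \bar R) :
  (forall i s, 0 <= g i s) ->
  expect p n (fun s => \sum_(i <- r) g i s) = \sum_(i <- r) expect p n (g i).
Proof.
move=> g0; elim: r => [|i r IH].
  rewrite big_nil -[RHS](expect0 n).
  by apply: eq_expect => s _; rewrite big_nil.
rewrite big_cons -IH -expectD//; last by move=> s; apply: sume_ge0.
by apply: eq_expect => s _; rewrite big_cons.
Qed.

Lemma expect_cat n m g : expect p (n + m) g =
  expect p n (fun s => expect p m (fun t => g (s ++ t))).
Proof.
elim: n g => [//|n IH] g /=.
by apply: eq_eseriesr => x _; rewrite IH.
Qed.

(** The factor [c] accumulates the probabilities of the letters already read, which lets the
    induction on the length close. *)
Lemma esum_expect n c g : (0 <= c)%R -> (forall s, 0 <= g s) ->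
  \esum_(s in [set s | size s = n]) ((c * \prod_(x <- s) p x)%R%:E * g s) =
  c%:E * expect p n g.
Proof.
elim: n c g => [|n IH] c g c0 g0 /=.
  rewrite (_ : [set s | size s = 0%N] = [set [::]]); last first.
    by apply/seteqP; split => s /=; [move/size0nil|move=> ->].
  by rewrite esum_set1 ?big_nil ?mulr1 ?mule_ge0 ?lee_fin.
rewrite (@reindex_esum _ _ _ ([set: nat] `*`` (fun=> [set s | size s = n]))
  _ (fun k : nat * seq nat => k.1 :: k.2)); last first.
  split => [[x s] /= [_ ->]//|[x s] [y t] _ _ /= [-> ->]//|].
  by move=> [//|x s] /= [sn]; exists (x, s).
have pr0 (s : seq nat) : (0 <= \prod_(x <- s) p x)%R by apply: prodr_ge0.
under eq_esum do rewrite big_cons mulrA.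
rewrite -(@esum_esum _ _ _ _ _ (fun x s =>
  ((c * p x * \prod_(y <- s) p y)%R%:E * g (x :: s)))); last first.
  by move=> x s _ _; rewrite mule_ge0 ?lee_fin ?mulr_ge0.
under eq_esum do rewrite IH ?mulr_ge0//.
rewrite -nneseries_esumT; last first.
  by move=> x; rewrite mule_ge0 ?lee_fin ?mulr_ge0// expect_ge0.
rewrite -nneseriesZl; last by move=> x _; rewrite mule_ge0 ?lee_fin// expect_ge0.
by apply: eq_eseriesr => x _; rewrite EFinM muleA.
Qed.

Lemma prob_nE n (A : seq nat -> Prop) :
  prob_n p n A = expect p n (fun s => ind (A s)).
Proof.
rewrite -[RHS]mul1e -esum_expect//; last by move=> s; exact: ind_ge0.
rewrite /prob_n (_ : [set s : seq nat | _ /\ _] =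
  [set s | size s = n] `&` [set s | A s]) // esum_mkcondr.
apply: eq_esum => s _; rewrite mul1r; case: ifPn.
  by rewrite inE/= => As; rewrite indT// mule1.
by rewrite notin_setE/= => As; rewrite indF// mule0.
Qed.

End Expectation.

(** * Letter counts and large letters under one law *)

Section Distr.
Context {R : realType}.
Variable p : nat -> R.
Hypothesis dp : is_distr p.

Let p_ge0 : forall x, 0 <= p x := dp.1.

Lemma cdfE B : cdf p B = series p B.+1.
Proof. by rewrite /cdf /series/= big_mkord. Qed.

Lemma le_series_distr m n : (m <= n)%N -> series p m <= series p n.
Proof. by apply/nondecreasing_series => i _ _; exact: p_ge0. Qed.

Lemma series_distr_le1 n : series p n <= 1.
Proof.
have := nondecreasing_cvgn_le _ (cvgP _ dp.2) n.
rewrite (cvg_lim _ dp.2)//; apply.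
by move=> i j; exact: le_series_distr.
Qed.

Lemma cdf_le1 B : cdf p B <= 1.
Proof. by rewrite cdfE series_distr_le1. Qed.

Lemma cdf_ge0 B : 0 <= cdf p B.
Proof. by apply: sumr_ge0 => i _; exact: p_ge0. Qed.

Lemma le_cdf m n : (m <= n)%N -> cdf p m <= cdf p n.
Proof. by move=> mn; rewrite !cdfE le_series_distr. Qed.

Lemma distr_le1 x : p x <= 1.
Proof.
apply: le_trans (cdf_le1 x); rewrite /cdf big_ord_recr/= lerDr.
by apply: sumr_ge0 => i _; exact: p_ge0.
Qed.

Lemma cdf_near1 (e : R) : 0 < e -> exists N, 1 - cdf p N <= e.
Proof.
move=> e0; have /cvgrPdist_le/(_ e e0)[N _ /(_ N.+1)] := dp.2.
move=> /(_ (leqnSn N)) h; exists N; rewrite cdfE.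
by apply: le_trans (ler_norm _) h.
Qed.

Lemma mean_if (D : pred nat) (m a b : R) :
  series (fun x => p x * (D x)%:R) n @[n --> \oo] --> m ->
  (\sum_(x <oo) (p x)%:E * (if D x then a else b)%:E =
   (m * a + (1 - m) * b)%:E)%E.
Proof.
move=> Dm.
have hc : (\sum_(0 <= x < n) p x * (if D x then a else b)) @[n --> \oo]
    --> (m * a + (1 - m) * b).
  rewrite (_ : (fun n => _) = (fun n =>
    (a - b) * series (fun x => p x * (D x)%:R) n + b * series p n)); last first.
    apply/funext => n; rewrite /series/= !big_distrr -big_split/=.
    by apply: eq_bigr => x _; case: (D x) => /=; ring.
  rewrite (_ : m * a + _ = (a - b) * m + b * 1); last by ring.
  by apply: cvgD; (apply: cvgM; first exact: cvg_cst) => //; exact: dp.2.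
apply/cvg_lim => //.
under eq_fun do under eq_bigr do rewrite -EFinM.
under eq_fun do rewrite sumEFin.
by apply: cvg_EFin => //; exact: nearW.
Qed.

Lemma mean_le (B : nat) (a b : R) :
  (\sum_(x <oo) (p x)%:E * (if (x <= B)%N then a else b)%:E =
   (cdf p B * a + (1 - cdf p B) * b)%:E)%E.
Proof.
apply: mean_if; apply: cvg_near_cst; exists B.+1 => // n /= Bn.
rewrite cdfE /series/= (big_cat_nat _ Bn)//= [X in _ + X]big1_seq ?addr0.
  rewrite big_nat [RHS]big_nat; apply: eq_bigr => i /andP[_ iB].
  by rewrite -ltnS iB mulr1.
move=> i /=; rewrite mem_index_iota => /andP[Bi _].
by rewrite leqNgt Bi/= mulr0.
Qed.

Lemma mean_eq (y : nat) (a b : R) :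
  (\sum_(x <oo) (p x)%:E * (if x == y then a else b)%:E =
   (p y * a + (1 - p y) * b)%:E)%E.
Proof.
apply: mean_if; apply: cvg_near_cst; exists y.+1 => // n /= yn.
rewrite /series/= (bigD1_seq y) ?mem_index_iota ?iota_uniq//= eqxx mulr1.
by rewrite big1 ?addr0// => i /negbTE ->; rewrite mulr0.
Qed.

Lemma expect_cst n (c : R) : expect p n (fun=> c%:E) = c%:E.
Proof.
elim: n => [//|n IH] /=.
transitivity (cdf p 0 * c + (1 - cdf p 0) * c)%:E; last by congr _%:E; ring.
by rewrite -mean_le; apply: eq_eseriesr => x _; rewrite IH if_same.
Qed.

Lemma expect_take m n (g : seq nat -> R) : (m <= n)%N ->
  expect p n (fun s => (g (take m s))%:E) = expect p m (fun s => (g s)%:E).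
Proof.
move=> mn; rewrite -(subnKC mn) expect_cat; apply: eq_expect => s sm.
rewrite -[RHS](expect_cst (n - m)); apply: eq_expect => t _.
by rewrite take_size_cat.
Qed.

(** This is the variance of a binomial count. The shift [c] serves the induction: reading a letter
    moves it by [1 - p x] or by [- p x], a change of mean zero. *)
Lemma expect_sqr_dev x n (c : R) :
  expect p n (fun s => (((count_mem x s)%:R - n%:R * p x + c) ^+ 2)%:E) =
  (n%:R * (p x * (1 - p x)) + c ^+ 2)%:E.
Proof.
elim: n c => [|n IH] c /=; first by rewrite !mul0r subr0 !add0r.
rewrite (@eq_eseriesr _ _ (fun y => (p y)%:E * (if y == x then
   n%:R * (p x * (1 - p x)) + (c + 1 - p x) ^+ 2 else
   n%:R * (p x * (1 - p x)) + (c - p x) ^+ 2)%:E)%E); last first.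
  move=> y _; congr (_ * _)%E; case: ifPn => yx; rewrite -IH;
    apply: eq_expect => s _; congr (_%:E).
    by rewrite natrD -natr1/=; ring.
  by rewrite natrD -natr1/=; ring.
by rewrite mean_eq -natr1; congr (_%:E); ring.
Qed.

(** Bounding the variance [p x * (1 - p x)] by 1 makes the estimate uniform in the law. *)
Lemma chebyshev_count x n (e : R) : (0 < n)%N -> 0 < e ->
  (expect p n (fun s => ind (e <= `|(count_mem x s)%:R / n%:R - p x|)%R) <=
   ((n%:R * e ^+ 2)^-1)%:E)%E.
Proof.
move=> n0 e0; have n0' : 0 < n%:R :> R by rewrite ltr0n.
have c0 : 0 <= ((n%:R * e) ^+ 2)^-1 by rewrite invr_ge0 sqr_ge0.
apply: (@le_trans _ _ (expect p n (fun s => (((n%:R * e) ^+ 2)^-1)%:E *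
   (((count_mem x s)%:R - n%:R * p x + 0) ^+ 2)%:E)%E)).
  apply: le_expect => // [s|s _]; first exact: ind_ge0.
  case: (pselect (e <= `|(count_mem x s)%:R / n%:R - p x|)) => h; last first.
    by rewrite indF// -EFinM lee_fin mulr_ge0// sqr_ge0.
  rewrite indT// -EFinM lee_fin ler_pdivlMl ?exprn_gt0 ?mulr_gt0// mulr1.
  rewrite addr0 -[leRHS]real_normK ?num_real//.
  rewrite ler_sqr ?nnegrE ?normr_ge0//; last by rewrite mulr_ge0 ?(ltW e0).
  rewrite (_ : _ - _ = n%:R * ((count_mem x s)%:R / n%:R - p x)); last first.
    by field; rewrite gt_eqF.
  by rewrite normrM (gtr0_norm n0') ler_pM2l.
rewrite expectZ//; last by move=> s; rewrite lee_fin sqr_ge0.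
rewrite expect_sqr_dev -EFinM lee_fin expr0n addr0.
have pp : p x * (1 - p x) <= 1.
  rewrite -[leRHS]mulr1 ler_pM// ?subr_ge0 ?distr_le1// gerBl p_ge0//.
rewrite (_ : _^-1 * _ = (n%:R * e ^+ 2)^-1 * (p x * (1 - p x))).
  by rewrite ler_piMr// invr_ge0 mulr_ge0 ?sqr_ge0.
by field; rewrite !gt_eqF.
Qed.

Lemma expect_has_gt n B :
  (expect p n (fun s => ind (has (fun y => B < y)%N s)) <=
   (n%:R * (1 - cdf p B))%:E)%E.
Proof.
elim: n => [|n IH] /=; first by rewrite indF// mul0r.
apply: (@le_trans _ _ (\sum_(x <oo) ((p x)%:E *
  (if (x <= B)%N then n%:R * (1 - cdf p B) else 1)%:E))%E).
  apply: lee_nneseries => [x _ _|x _].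
    by rewrite mule_ge0 ?lee_fin// expect_ge0// => s; exact: ind_ge0.
  rewrite lee_wpmul2l ?lee_fin//; case: leqP => xB /=; first exact: IH.
  by rewrite -[leRHS](expect_cst n) le_expect// => s; rewrite ?ind_ge0// indT.
rewrite mean_le lee_fin -natr1; move: (cdf p B) (cdf_le1 B) => c c1.
by have : 0 <= n%:R * (1 - c) ^+ 2; [rewrite mulr_ge0 ?sqr_ge0|nra].
Qed.

Fixpoint first_exit (B f : nat) (s : seq nat) : bool :=
  if s is x :: t then (f < x)%N || ((x <= B)%N && first_exit B f t) else false.

(** Some letter exceeds [B] with probability at least [1 - (1 - a) ^+ n], and the first such letter
    exceeds [f] with conditional probability at least 1/2. *)
Lemma expect_first_exit (a : R) B f n : (B <= f)%N -> 0 <= a <= 1 ->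
  a <= 1 - cdf p f -> 1 - cdf p B <= 2 * a ->
  (((1 - (1 - a) ^+ n) / 2)%:E <= expect p n (fun s => ind (first_exit B f s)))%E.
Proof.
move=> Bf /andP[a0 a1] af Ba; elim: n => [|n IH] /=.
  by rewrite expr0 subrr mul0r ind_ge0.
set w := (1 - a) ^+ n in IH *.
have [w0 w1] : 0 <= w /\ w <= 1.
  by split; [apply: exprn_ge0; lra|apply: exprn_ile1; lra].
(* The first letter either stays within [B], which leaves the induction hypothesis for the rest, or
   exceeds [f] at once; [B <= f] makes these cases disjoint. *)
apply: (@le_trans _ _ (\sum_(x <oo) (((p x)%:E *
   (if (x <= B)%N then (1 - w) / 2 else 0)%:E +
   (p x)%:E * (if (x <= f)%N then 0 else 1)%:E)))%E).
  rewrite nneseriesD; last 2 first.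
  - by move=> x _ _; rewrite mule_ge0 ?lee_fin//; case: ifP => // _; lra.
  - by move=> x _ _; rewrite mule_ge0 ?lee_fin//; case: ifP => // _; lra.
  rewrite !mean_le -EFinD lee_fin exprS -/w.
  have := cdf_ge0 B; nra.
apply: lee_nneseries => [x _ _|x _].
  by rewrite adde_ge0 // mule_ge0 ?lee_fin//; case: ifP => // _; lra.
rewrite -ge0_muleDr ?lee_fin; last 2 first.
- by case: ifP => // _; lra.
- by case: ifP => // _; lra.
rewrite lee_wpmul2l ?lee_fin// -EFinD; case: (leqP x f) => xf /=.
  rewrite addr0; case: leqP => xB /=; first exact: IH.
  by apply: expect_ge0 => // s; exact: ind_ge0.
rewrite leqNgt (leq_ltn_trans Bf xf) /= add0r -[leLHS](expect_cst n).
by apply: le_expect => // s _; rewrite indT.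
Qed.

End Distr.

(** Each letter up to [B] loses a factor of at most [l]. This carries the entry event from [p] over
    to nearby laws. *)
Lemma expect_domination {R : realType} (p q : nat -> R) (l : R) B n g :
  (forall x, 0 <= p x) -> (forall x, 0 <= q x) -> 0 <= l ->
  (forall x, (x <= B)%N -> l * p x <= q x) ->
  (forall s, 0 <= g s)%E -> (forall s, ~~ all (fun x => x <= B)%N s -> g s = 0%E) ->
  ((l ^+ n)%:E * expect p n g <= expect q n g)%E.
Proof.
move=> p0 q0 l0 lpq; elim: n g => [|n IH] g g0 gB /=; first by rewrite mul1e.
rewrite -nneseriesZl; last by move=> x _; rewrite mule_ge0 ?lee_fin// expect_ge0.
apply: lee_nneseries => [x _ _|x _].
  by rewrite !mule_ge0 ?lee_fin ?exprn_ge0// expect_ge0.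
case: (leqP x B) => xB; last first.
  suff h r : expect r n (fun s => g (x :: s)) = 0%E by rewrite !h !mule0.
  rewrite -(expect0 r n); apply: eq_expect => s _; apply: gB => /=.
  by rewrite leqNgt xB.
apply: (@le_trans _ _ ((l * p x)%:E * ((l ^+ n)%:E * expect p n (fun s => g (x :: s))))%E).
  by rewrite exprS muleA muleA -!EFinM (_ : l * l ^+ n * p x = l * p x * l ^+ n) //; ring.
apply: lee_pmul.
- by rewrite lee_fin mulr_ge0.
- by rewrite mule_ge0 ?lee_fin ?exprn_ge0// expect_ge0.
- by rewrite lee_fin lpq.
- apply: IH => // s h; apply: gB => /=; rewrite negb_and h orbT //.
Qed.

(** * Quantiles and tightness *)

Section Quantile.
Context {R : realType}.
Variable q : nat -> R.
Hypothesis dq : is_distr q.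

Lemma prev_node_le (z : R) : (prev_node q z <= Num.truncn z)%N.
Proof. by apply/bigmax_leqP => i _; rewrite -ltnS. Qed.

Lemma cdf_prev_node (z : R) : cdf q (prev_node q z) = cdf q (Num.truncn z).
Proof.
have at' := prev_node_le z.
rewrite !cdfE /series/= [RHS](big_cat_nat (n := (prev_node q z).+1))//=.
rewrite [X in _ + X]big1_seq ?addr0// => i /=; rewrite mem_index_iota => /andP[ai it].
apply/eqP; apply: contraTT ai => qi; rewrite -leqNgt.
rewrite /prev_node -[i]/(val (Ordinal it)); apply: leq_bigmax_cond.
by rewrite /node lt0r qi dq.1 orbT.
Qed.

Lemma cdf_le_Fp (z : R) : 0 <= z -> cdf q (Num.truncn z) <= Fp q z.
Proof.
move=> z0; rewrite -cdf_prev_node /Fp.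
have := prev_node_le z; move: (prev_node q z) => a az.
case: pselect => // H; case: ex_minnP => b /andP[tb _] _.
have az' : a%:R <= z by apply: (@le_trans _ _ (Num.truncn z)%:R); rewrite ?truncn_le// ler_nat.
have ab : (a < b)%N by exact: leq_ltn_trans tb.
rewrite lerDl mulr_ge0// ?subr_ge0 ?le_cdf// ?(ltnW ab)//.
by rewrite divr_ge0 ?subr_ge0// ler_nat ltnW.
Qed.

Lemma cdf_lt_of_Finv (N : nat) (x : R) : (N%:R%:E < Finv q x)%E -> cdf q N < x.
Proof.
apply: contraTT; rewrite -leNgt -leNgt => xN.
apply: ereal_inf_lbound; exists N%:R => //=; split => //.
by apply: (le_trans xN); have := @cdf_le_Fp N%:R (ler0n _ _); rewrite natrK.
Qed.

(* Interpolation moves the quantile by a factor of at most two at the price of halving the tail. *)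
Lemma Finv_ge_of_cdf (N : nat) (d : R) : d < 1 - cdf q N ->
  ((N.+1%:R / 2)%:E <= Finv q (1 - d / 2))%E.
Proof.
move=> dN; apply: le_ereal_inf_tmp => _ /= [z [z0 +] <-]; rewrite lee_fin.
apply: contraTT; rewrite -!ltNge => zN.
have N1 : N.+1%:R = N%:R + 1 :> R by rewrite -natr1.
have tN : (Num.truncn z <= N)%N.
  rewrite -ltnS -(ltr_nat R); apply: (@le_lt_trans _ _ z); first by rewrite truncn_le.
  by rewrite N1 in zN *; have : 0 <= N%:R :> R := ler0n _ _; lra.
have aN : cdf q (prev_node q z) <= cdf q N by rewrite cdf_prev_node le_cdf.
have az := prev_node_le z; have c1 := cdf_le1 dq N.
rewrite /Fp; case: pselect => [H|H]; last first.
  suff : cdf q (prev_node q z) = 1 by lra.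
  apply/eqP; rewrite eq_le cdf_le1//=; apply/ler_addgt0Pr => e e0.
  have [M] := cdf_near1 dq e0; rewrite cdf_prev_node.
  suff : cdf q M <= cdf q (Num.truncn z) by lra.
  case: (leqP M (Num.truncn z)) => [|tM]; first exact: le_cdf.
  rewrite !cdfE /series/= (big_cat_nat (n := (Num.truncn z).+1))//=; last exact: ltnW.
  rewrite [X in _ + X]big1_seq ?addr0// => i /=; rewrite mem_index_iota => /andP[ti _].
  apply/eqP/negPn/negP => qi; apply: H; exists i.
  by rewrite ti lt0r qi dq.1.
case: ex_minnP => b /andP[tb _] _.
set a := prev_node q z in aN az *.
have ab : (a < b)%N by exact: leq_ltn_trans tb.
have ab' : a%:R < b%:R :> R by rewrite ltr_nat.
have cab : cdf q a <= cdf q b by rewrite le_cdf// ltnW.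
have [bN|Nb] := leqP b N.
  suff : (z - a%:R) / (b%:R - a%:R) * (cdf q b - cdf q a) <= cdf q b - cdf q a.
    by have := le_cdf dq bN; lra.
  rewrite ler_piMl ?subr_ge0// ler_pdivrMr ?subr_gt0// mul1r lerD2r.
  have := truncnS_gt z; have : (Num.truncn z).+1%:R <= b%:R :> R by rewrite ler_nat.
  lra.
have Nb' : N.+1%:R <= b%:R :> R by rewrite ler_nat.
(* Here [2 * z < N + 1 <= b], so [z] lies in the first half of the interval from [a] to [b] and at
   most half of the jump is counted. *)
suff : (z - a%:R) / (b%:R - a%:R) * (cdf q b - cdf q a) <= (cdf q b - cdf q a) / 2.
  have := cdf_le1 dq b; lra.
rewrite [leRHS]mulrC ler_wpM2r ?subr_ge0// ler_pdivrMr ?subr_gt0//.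
by have : 0 <= a%:R :> R := ler0n _ _; lra.
Qed.

End Quantile.

Definition tight {R : realType} (U : set (nat -> R)) : Prop :=
  forall d : R, 0 < d -> exists N, forall q, U q -> 1 - cdf q N <= d.

Lemma sub_tight {R : realType} (U V : set (nat -> R)) :
  U `<=` V -> tight V -> tight U.
Proof. by move=> UV tV d d0; have [N h] := tV d d0; exists N => q /UV/h. Qed.

(** If tightness fails at level [d] in the ball of radius [eps], then [d / 2] is a valid [delta] for
    deceptiveness; the halving pays for the interpolation. *)
Lemma not_deceptive_tight {R : realType} (P : set (nat -> R)) p :
  (forall p, P p -> is_distr p) -> ~ deceptive P p ->
  exists2 eps : R, 0 < eps & tight [set q | P q /\ dist p q < eps].
Proof.
move=> HP; apply: contra_notP => nt eps eps0.
have /existsNP[d /not_implyP[d0 /forallNP nd]] :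
  ~ tight [set q | P q /\ dist p q < eps] by move=> t; apply: nt; exists eps.
exists (d / 2); first by rewrite divr_gt0.
move=> f; have /existsNP[q /not_implyP[[Pq pq] /negP]] := nd (Num.truncn (2 * f)).+1.
rewrite -ltNge => dN; exists q; split => //; split => //.
apply: lt_le_trans (Finv_ge_of_cdf (HP _ Pq) dN); rewrite lte_fin.
have := truncnS_gt (2 * f); rewrite -[in X in _ -> X]natr1; lra.
Qed.

(** * The divergence [dist] *)

Section Divergence.
Context {R : realType}.

Lemma ln_le_subr1 (x : R) : 0 < x -> ln x <= x - 1.
Proof.
move=> x0; have := @le_ln1Dx R (x - 1).
by rewrite (_ : 1 + (x - 1) = x); [apply; lra|ring].
Qed.

Lemma entropy_term_le (u m : R) : 0 <= u -> 0 < m -> u * ln (u / m) <= u * (u - m) / m.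
Proof.
rewrite le_eqVlt => /predU1P[<- _|u0 m0]; first by rewrite !mul0r.
rewrite -mulrA ler_pM2l//; apply: le_trans (ln_le_subr1 _) _; first exact: divr_gt0.
by rewrite mulrBl divff// gt_eqF.
Qed.

(* [ln x = 2 ln (sqrt x) >= 2 (1 - 1 / sqrt x)] bounds the term below by [u - m + (sqrt u - sqrt m)^2]. *)
Lemma entropy_term_ge (u m : R) : 0 <= u <= 1 -> 0 < m <= 1 ->
  u - m + (u - m) ^+ 2 / 4 <= u * ln (u / m).
Proof.
move=> /andP[u0 u1] /andP[m0 m1].
have [->|un0] := eqVneq u 0.
  by rewrite mul0r; nra.
have {un0}u0 : 0 < u by rewrite lt0r un0.
pose a := Num.sqrt u; pose b := Num.sqrt m.
have a0 : 0 < a by rewrite sqrtr_gt0.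
have b0 : 0 < b by rewrite sqrtr_gt0.
have ua : u = a ^+ 2 by rewrite sqr_sqrtr// ltW.
have mb : m = b ^+ 2 by rewrite sqr_sqrtr// ltW.
have a1 : a <= 1 by rewrite -[leRHS]sqrtr1 ler_wsqrtr.
have b1 : b <= 1 by rewrite -[leRHS]sqrtr1 ler_wsqrtr.
have -> : u / m = (b / a) ^- 2 by rewrite ua mb; field; rewrite !gt_eqF.
rewrite lnV ?posrE ?exprn_gt0 ?divr_gt0// lnXn ?divr_gt0//.
have h : ln (b / a) <= b / a - 1 by apply: ln_le_subr1; exact: divr_gt0.
have h2 : u * (2 - 2 * (b / a)) <= u * - (ln (b / a) *+ 2).
  by rewrite ler_pM2l// -mulr_natl; lra.
apply: le_trans h2.
have -> : u * (2 - 2 * (b / a)) = u - m + (a - b) ^+ 2.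
  by rewrite ua mb; field; rewrite gt_eqF.
rewrite lerD2l ua mb ler_pdivrMr//.
have -> : (a ^+ 2 - b ^+ 2) ^+ 2 = (a - b) ^+ 2 * (a + b) ^+ 2 by ring.
rewrite ler_wpM2l ?sqr_ge0//; nra.
Qed.

Let mid (p q : nat -> R) := fun y => (p y + q y) / 2.

Definition js_term (p q : nat -> R) (x : nat) : R :=
  p x * log2 (p x / mid p q x) + q x * log2 (q x / mid p q x).

Let ln2_gt0 : 0 < ln 2 :> R.
Proof. by apply: ln_gt0; lra. Qed.

Lemma js_termE (p q : nat -> R) x : js_term p q x =
  (p x * ln (p x / mid p q x) + q x * ln (q x / mid p q x)) / ln 2.
Proof. by rewrite /js_term /log2 !mulrA -mulrDl. Qed.

(** At the midpoint the linear parts of the two lower bounds cancel, and each quadratic part equals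
    [(p x - q x) ^+ 2 / 16]. *)
Lemma js_term_ge (p q : nat -> R) x : is_distr p -> is_distr q ->
  (p x - q x) ^+ 2 / 8 / ln 2 <= js_term p q x.
Proof.
move=> dp dq; rewrite js_termE ler_pM2r ?invr_gt0// /mid.
have [p0 q0] := (dp.1 x, dq.1 x).
have [p1 q1] := (distr_le1 dp x, distr_le1 dq x).
move: (p x) (q x) p0 q0 p1 q1 => a b a0 b0 a1 b1.
have [m0|] := ltP 0 ((a + b) / 2); last first.
  by move=> ?; have -> : a = 0 by [lra]; have -> : b = 0 by [lra]; rewrite !mul0r; lra.
have m1 : 0 < (a + b) / 2 <= 1 by apply/andP; split => //; lra.
have h1 := @entropy_term_ge a _ _ m1; have h2 := @entropy_term_ge b _ _ m1.
move: h1 h2; rewrite a0 b0 => /(_ a1) h1 /(_ b1) h2.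
apply: le_trans (lerD h1 h2).
rewrite le_eqVlt; apply/orP; left; by apply/eqP; field.
Qed.

(** With [a = p x] and [b = q x], the two upper bounds add up to [(a - b) ^+ 2 / (a + b)]. *)
Lemma js_term_le (p q : nat -> R) x : is_distr p -> is_distr q ->
  js_term p q x <= `|p x - q x| / ln 2.
Proof.
move=> dp dq; rewrite js_termE ler_pM2r ?invr_gt0// /mid.
have [a0 b0] := (dp.1 x, dq.1 x).
move: (p x) (q x) a0 b0 => a b a0 b0.
have [m0|] := ltP 0 ((a + b) / 2); last first.
  by move=> ?; have -> : a = 0 by [lra]; have -> : b = 0 by [lra]; rewrite !mul0r subr0 normr0 addr0.
apply: le_trans (lerD (entropy_term_le a0 m0) (entropy_term_le b0 m0)) _.
have s0 : 0 < a + b by lra.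
have -> : a * (a - (a + b) / 2) / ((a + b) / 2) +
  b * (b - (a + b) / 2) / ((a + b) / 2) = (a - b) ^+ 2 / (a + b).
  by field; rewrite gt_eqF.
rewrite ler_pdivrMr// -real_normK ?num_real// expr2 ler_wpM2l//.
by rewrite ler_norml; lra.
Qed.

(** The terms may have either sign, so absolute convergence is shown, by comparison with
    [(p + q) / ln 2]. Without convergence the [limn] in [KL] would carry no information. *)
Lemma is_cvg_KL_mid (p q : nat -> R) : is_distr p -> is_distr q ->
  cvgn (series (fun x => p x * log2 (p x / mid p q x))).
Proof.
move=> dp dq; apply: normed_cvg.
pose v : nat -> R := (ln 2)^-1 *: (p + q).
have vE n : v n = (ln 2)^-1 * (p n + q n) by [].
apply: (@series_le_cvg _ _ v) => [n|n|n|].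
- by rewrite normr_ge0.
- by rewrite vE mulr_ge0 ?invr_ge0 ?(ltW ln2_gt0)// addr_ge0 ?dp.1 ?dq.1.
- rewrite /= /log2 mulrA normrM [`|_^-1|]gtr0_norm ?invr_gt0// vE mulrC.
  rewrite ler_pM2l ?invr_gt0// /mid.
  have [a0 b0] := (dp.1 n, dq.1 n).
  have [a1 b1] := (distr_le1 dp n, distr_le1 dq n).
  move: (p n) (q n) a0 b0 a1 b1 => a b a0 b0 a1 b1.
  have [m0|] := ltP 0 ((a + b) / 2); last first.
    by move=> ?; have -> : a = 0 by [lra]; rewrite mul0r normr0; lra.
  have m1 : 0 < (a + b) / 2 <= 1 by apply/andP; split => //; lra.
  have := @entropy_term_ge a _ _ m1; rewrite a0 => /(_ a1) h.
  rewrite ler_norml; apply/andP; split; first by nra.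
  apply: le_trans (entropy_term_le a0 m0) _.
  rewrite ler_pdivrMr//; nra.
- apply: is_cvg_seriesZ; apply: is_cvg_seriesD.
    by apply/cvg_ex; exists 1; exact: dp.2.
  by apply/cvg_ex; exists 1; exact: dq.2.
Qed.

Lemma cvg_dist (p q : nat -> R) : is_distr p -> is_distr q ->
  series (js_term p q) n @[n --> \oo] --> dist p q.
Proof.
move=> dp dq; have h1 := is_cvg_KL_mid dp dq.
have h2 : cvgn (series (fun x => q x * log2 (q x / mid p q x))).
  rewrite (_ : mid p q = mid q p); first exact: is_cvg_KL_mid.
  by apply/funext => x; rewrite /mid addrC.
rewrite (_ : (fun n => series (js_term p q) n) = (fun n =>
    series (fun x => p x * log2 (p x / mid p q x)) n +
    series (fun x => q x * log2 (q x / mid p q x)) n)).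
  by rewrite /dist /KL; apply: cvgD; [exact: h1|exact: h2].
by apply/funext => n; rewrite /series/= -big_split.
Qed.

Lemma dist_lim (p q : nat -> R) : is_distr p -> is_distr q ->
  dist p q = limn (series (js_term p q)).
Proof. by move=> dp dq; apply/esym/cvg_lim => //; exact: cvg_dist. Qed.

Lemma sqr_le_dist (p q : nat -> R) x : is_distr p -> is_distr q ->
  (p x - q x) ^+ 2 <= 8 * ln 2 * dist p q.
Proof.
move=> dp dq.
have js0 y : 0 <= js_term p q y.
  apply: le_trans (js_term_ge y dp dq).
  by rewrite !divr_ge0 ?sqr_ge0// ltW.
have : js_term p q x <= dist p q.
  rewrite dist_lim//.
  apply: (@le_trans _ _ (series (js_term p q) x.+1)).
    by rewrite /series/= big_nat_recr//= lerDr sumr_ge0.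
  apply: nondecreasing_cvgn_le; last exact: (cvgP _ (cvg_dist dp dq)).
  by apply/nondecreasing_series.
move=> /(le_trans (js_term_ge x dp dq)).
by rewrite !ler_pdivrMr// => h; lra.
Qed.

(** Beyond [B] the differences are at most the two tails, and the tail of [q] exceeds that of [p] by
    at most the sum of the differences up to [B]. *)
Lemma dist_le_l1 (p q : nat -> R) B : is_distr p -> is_distr q ->
  dist p q <= 2 * (\sum_(x < B.+1) `|p x - q x| + (1 - cdf p B)) / ln 2.
Proof.
move=> dp dq; rewrite dist_lim//.
apply: limr_le; first exact: (cvgP _ (cvg_dist dp dq)).
exists B.+1 => // n /= Bn.
apply: (@le_trans _ _ (series (fun x => `|p x - q x| / ln 2) n)).
  by apply: ler_sum => x _; exact: js_term_le.
rewrite /series/= -mulr_suml ler_pM2r ?invr_gt0//.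
rewrite (big_cat_nat _ Bn)//=.
have h1 : \sum_(B.+1 <= x < n) `|p x - q x| <=
    (series p n - cdf p B) + (series q n - cdf q B).
  have e (r : nat -> R) : series r n - cdf r B = \sum_(B.+1 <= x < n) r x.
    by rewrite cdfE /series/= (big_cat_nat _ Bn)//= [LHS]addrC addKr.
  rewrite !e -big_split/=; apply: ler_sum => x _.
  by rewrite (le_trans (ler_normB _ _))// !ger0_norm ?dp.1 ?dq.1.
have h2 : cdf p B - cdf q B <= \sum_(x < B.+1) `|p x - q x|.
  by rewrite -sumrB; apply: ler_sum => x _; exact: ler_norm.
have [h3 h4] := (series_distr_le1 dp n, series_distr_le1 dq n).
rewrite big_mkord; lra.
Qed.

Lemma dist_lt_of_close (p : nat -> R) (eps : R) : is_distr p -> 0 < eps ->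
  exists k0, forall k q, (k0 <= k)%N -> is_distr q ->
    (forall x, (x <= k)%N -> `|p x - q x| <= 2 / k.+1%:R) -> dist p q < eps.
Proof.
(* The differences up to [B] will sum to at most [2 * e] and the tail of [p] is at most [e], which
   gives [6 * e / ln 2]; the 7 makes the inequality strict. *)
move=> dp eps0; pose e := eps * ln 2 / 7.
have e0 : 0 < e by rewrite !divr_gt0 ?mulr_gt0.
have [B Be] := cdf_near1 dp e0.
exists (maxn B (Num.truncn (B.+1%:R / e)).+1) => k q; rewrite geq_max => /andP[Bk ek] dq h.
apply: le_lt_trans (dist_le_l1 B dp dq) _; rewrite ltr_pdivrMr//.
have : \sum_(x < B.+1) `|p x - q x| <= 2 * e.
  apply: (@le_trans _ _ (\sum_(x < B.+1) (2 / k.+1%:R))).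
    apply: ler_sum => x _; apply: h; apply: leq_trans Bk; by rewrite -ltnS.
  rewrite sumr_const card_ord -[leLHS]mulr_natl.
  have k0 : 0 < k.+1%:R :> R by rewrite ltr0n.
  have -> : B.+1%:R * (2 / k.+1%:R) = 2 * (B.+1%:R / k.+1%:R) :> R by rewrite mulrCA.
  rewrite ler_pM2l; last by lra.
  rewrite ler_pdivrMr// mulrC -ler_pdivrMr//.
  apply: ltW; apply: lt_le_trans (truncnS_gt _) _.
  by rewrite ler_nat (leq_trans ek).
have : eps * ln 2 = 7 * e by rewrite /e; field.
lra.
Qed.

(** If [q y < l * p y], then [p y - q y] exceeds [(1 - l) * p y], which [sqr_le_dist] forbids at
    small distance; finitely many letters allow a common radius. *)
Lemma dist_lower_semicont (p : nat -> R) (l : R) B : is_distr p -> l < 1 ->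
  exists2 eps : R, 0 < eps & forall q, is_distr q -> dist p q < eps ->
    forall x, (x <= B)%N -> l * p x <= q x.
Proof.
move=> dp l1.
have h y : exists2 eps : R, 0 < eps & forall q, is_distr q -> dist p q < eps ->
    l * p y <= q y.
  have [p0|p0] := eqVneq (p y) 0.
    by exists 1 => // q dq _; rewrite p0 mulr0 dq.1.
  have {}p0 : 0 < p y by rewrite lt0r p0 dp.1.
  have c0 : 0 < (1 - l) * p y by rewrite mulr_gt0// subr_gt0.
  exists (((1 - l) * p y) ^+ 2 / (8 * ln 2)).
    by apply: divr_gt0; [exact: exprn_gt0|rewrite mulr_gt0].
  move=> q dq; rewrite ltr_pdivlMr ?mulr_gt0// => pq.
  have := sqr_le_dist y dp dq; rewrite mulrC => h.
  rewrite leNgt; apply/negP => qp.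
  have := le_lt_trans h pq; rewrite ltr_sqr ?nnegrE; lra.
elim: B => [|B [e e0 IH]].
  by have [e e0 he] := h 0; exists e => // q dq pq [|//] _; exact: he.
have [e' e'0 he'] := h B.+1; exists (Num.min e e'); first by rewrite lt_min e0.
move=> q dq; rewrite lt_min => /andP[pe pe'] x; rewrite leq_eqVlt => /predU1P[->|xB].
  exact: he'.
exact: IH.
Qed.

End Divergence.

(** * Deceptive laws prevent insurability *)

Section Necessity.
Context {R : realType}.

Lemma bounded_on_words (Pi : seq nat -> R) B L : exists M, forall s,
  (size s <= L)%N -> all (fun x => x <= B)%N s -> Pi s <= M.
Proof.
elim: L Pi => [|L IH] Pi; first by exists (Pi [::]) => s; rewrite leqn0 size_eq0 => /eqP ->.
have /choice[M hM] x := IH (fun s => Pi (x :: s)).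
exists (`|Pi [::]| + \sum_(x < B.+1) `|M x|) => -[_ _|x s /= sL /andP[xB sB]].
  by rewrite (le_trans (ler_norm _))// lerDl sumr_ge0.
apply: le_trans (hM x s sL sB) _; apply: le_trans (ler_norm _) _.
have xB' : (x < B.+1)%N by [].
by rewrite (bigD1 (Ordinal xB'))//= addrCA lerDl addr_ge0// sumr_ge0.
Qed.

Lemma stopped_cat (tau : seq nat -> bool) s t :
  (forall s x, tau s -> tau (rcons s x)) -> tau s -> tau (s ++ t).
Proof.
move=> mono; elim: t s => [|x t IH] s ts; first by rewrite cats0.
by rewrite -cat_rcons; apply: IH; exact: mono.
Qed.

Lemma first_exitP B f t : first_exit B f t ->
  exists j, [/\ (j < size t)%N, all (fun x => x <= B)%N (take j t) & (f < nth 0 t j)%N].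
Proof.
elim: t => [//|x t IH] /= /orP[fx|/andP[xB /IH[j [jt aj fj]]]].
  by exists 0%N.
by exists j.+1; split => //=; rewrite xB.
Qed.

Lemma all_take_le (a : pred nat) i j w : (i <= j)%N -> all a (take j w) -> all a (take i w).
Proof.
by move=> ij; rewrite -[take j w](cat_take_drop i) all_cat take_takel// => /andP[].
Qed.

(** Losses only lower the capital, so at most [Pi0 + N.+1 * M] is available to meet the loss at
    index [N]. *)
Lemma capital_lt0 (Pi0 M : R) (tau : seq nat -> bool) (Pi : seq nat -> R) w N B f :
  (forall s, (size s <= N)%N -> all (fun x => x <= B)%N s -> Pi s <= M) ->
  0 <= M -> all (fun x => x <= B)%N (take N w) -> tau (take N w) ->
  (f < nth 0 w N)%N -> Pi0 + N.+1%:R * M <= f%:R ->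
  capital Pi0 tau Pi w N.+1 < 0.
Proof.
move=> hM M0 aw tw fw fM; rewrite /capital big_ord_recr/= tw mulr1.
have h i : (i <= N)%N -> Pi (take i w) <= M.
  by move=> iN; apply: hM (all_take_le iN aw); rewrite size_take_min geq_min iN.
have s : \sum_(i < N) (Pi (take i w) - (nth 0%N w i)%:R) * (tau (take i w))%:R
    <= \sum_(i < N) M.
  apply: ler_sum => i _; have := h i (ltnW (ltn_ord i)).
  have : 0 <= (nth 0%N w i)%:R :> R := ler0n _ _.
  by case: (tau _) => /=; rewrite ?mulr1 ?mulr0//; lra.
have hN := h N (leqnn _).
have : f%:R < (nth 0%N w N)%:R :> R by rewrite ltr_nat.
move: s fM; rewrite sumr_const card_ord -mulr_natl -natr1; lra.
Qed.

(** Otherwise [E] would propagate from [d] to every [2 ^+ k * d], beyond the bound 1. *)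
Lemma doubling (E : R -> Prop) d : 0 < d -> (forall a, E a -> a <= 1) -> E d ->
  exists a, [/\ 0 < a, E a & ~ E (2 * a)].
Proof.
move=> d0 E1 Ed; apply: contrapT => nE.
have h k : E (2 ^+ k * d).
  elim: k => [|k IH]; first by rewrite mul1r.
  apply: contrapT => nEk; apply: nE; exists (2 ^+ k * d); split => //.
    by rewrite mulr_gt0 ?exprn_gt0.
  by rewrite mulrA -exprS.
pose k := (Num.truncn d^-1).+1.
have := E1 _ (h k); rewrite leNgt => /negP; apply.
rewrite -ltr_pdivrMr// div1r; apply: lt_trans (truncnS_gt _) _.
by rewrite -natrX ltr_nat ltn_expl.
Qed.

Lemma expr_small (a : R) : 0 < a <= 1 -> exists K, (1 - a) ^+ K <= 1 / 2.
Proof.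
move=> /andP[a0 a1].
have : (1 - a) ^+ n @[n --> \oo] --> (0 : R).
  by apply: cvg_expr; rewrite ger0_norm; lra.
move=> /cvgrPdist_le/(_ (1 / 2))[|K _ /(_ K (leqnn K))]; first lra.
by rewrite sub0r normrN /= => h; exists K; apply: le_trans (ler_norm _) h.
Qed.

(* With [a] maximal up to a factor 2, a loss above [B] also exceeds any prescribed [f] with
   probability at least 1/2 for a suitable [q] close to [p]. *)
Lemma insurable_not_deceptive (P : set (nat -> R)) Pi0 p :
  (forall p, P p -> is_distr p) -> 0 <= Pi0 -> insurable P Pi0 -> P p -> ~ deceptive P p.
Proof.
move=> HP Pi00 ins Pp dec; have dp := HP _ Pp.
(* The level 1/32 lies below 1/16, the product of the probabilities 1/4 of entry and of a ruinous
   exit obtained below. *)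
have [|tau [Pi [[mono [stop [Pi_ge0 _]]] bank]]] := ins (1 / 32); first lra.
have [n] : exists n, ((3 / 4)%:E < expect p n (fun s => ind (tau s)))%E.
  have : ((3 / 4)%:E < prob_incr_union p (fun _ s => tau s))%E.
    by rewrite stop// lte_fin; lra.
  move=> /ereal_sup_gt[_ [n _ <-]]; rewrite prob_nE; last exact: dp.1.
  by exists n.
move=> ptau.
have [B0 hB0] : exists B0, n%:R * (1 - cdf p B0) <= 1 / 4.
  have e0 : 0 < (1 / 4) / n.+1%:R :> R by rewrite divr_gt0// ?ltr0n; lra.
  have [B0 h] := cdf_near1 dp e0; exists B0.
  move: h; rewrite ler_pdivlMr ?ltr0n// -natr1.
  have := cdf_le1 dp B0; nra.
pose S B s := tau s && all (fun x => x <= B)%N s.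
have pS : ((1 / 2)%:E <= expect p n (fun s => ind (S B0 s)))%E.
  have := expect_has_gt dp n B0; set h := expect p n _ => hh.
  have : (expect p n (fun s => ind (tau s)) <= expect p n (fun s => ind (S B0 s)) + h)%E.
    rewrite /h -(expectD dp.1) => [|s|s]; [|exact: ind_ge0|exact: ind_ge0].
    apply: (le_expect dp.1) => [s|s _]; first exact: ind_ge0.
    case: (pselect (tau s)) => ts; last by rewrite indF ?adde_ge0 ?ind_ge0.
    case: (pselect (all (fun x => x <= B0)%N s)) => as_.
      by rewrite (indT ts) (@indT _ (S B0 s)) ?/S ?ts// leeDl ?ind_ge0.
    rewrite (indT ts) (@indT _ (has _ s)) ?leeDr ?ind_ge0//.
    by move/negP: as_; rewrite -has_predC; apply: sub_has => x /=; rewrite ltnNge.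
  move=> hS; have {hS} := lt_le_trans ptau hS; move: hh.
  have h0 : (0 <= h)%E by rewrite /h; apply: (expect_ge0 dp.1) => s; exact: ind_ge0.
  have := @expect_ge0 R p dp.1 n (fun s => ind (S B0 s)) (fun s => ind_ge0 _).
  case: (expect p n _) => [x||//]; last by move=> *; rewrite leey.
  move: h0; case: h => [y||//]; last by move=> _ _; rewrite leye_eq.
  by rewrite -EFinD !lee_fin lte_fin; lra.
(* With [l = 1 - c], Bernoulli's inequality turns [n * c <= 1 / 2] into [l ^+ n >= 1 / 2]. *)
have [c [c0 c1 nc]] : exists c : R, [/\ 0 < c, c <= 1 & n%:R * c <= 1 / 2].
  have n0 : 0 <= n%:R :> R by [].
  exists (2 * (n%:R + 1))^-1; split; first by rewrite invr_gt0; lra.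
    by rewrite invf_le1; lra.
  by rewrite ler_pdivrMr; lra.
pose l : R := 1 - c.
have l01 : 0 <= l < 1 by rewrite /l; apply/andP; split; lra.
have ln : 1 / 2 <= l ^+ n.
  have bern m : 1 - m%:R * c <= l ^+ m.
    elim: m => [|m IH]; first by rewrite mul0r subr0.
    rewrite exprSr -natr1 mulrDl mul1r.
    have lm : l ^+ m <= 1 by apply: exprn_ile1; [case/andP: l01|case/andP: l01 => _ /ltW].
    rewrite {2}/l mulrBr mulr1; nra.
  by apply: le_trans (bern n); lra.
have [eps eps0 heps] := dist_lower_semicont B0 dp (proj2 (andP l01)).
(* Deceptiveness provides a level that escapes, and [doubling] then one whose double does not. *)
pose escape a := forall f : nat, exists q, P q /\ dist p q < eps /\ a <= 1 - cdf q f.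
have esc1 a : escape a -> a <= 1.
  by move=> /(_ 0%N)[q [Pq [_ h]]]; have := cdf_ge0 (HP _ Pq) 0%N; lra.
have [d d0 hd] := dec _ eps0.
have escd : escape d.
  move=> f; have [q [Pq [pq h]]] := hd f%:R; exists q; do 2!split => //.
  have := cdf_lt_of_Finv (HP _ Pq) h; lra.
have [a [a0 ea nea]] := doubling d0 esc1 escd.
have a1 := esc1 _ ea.
(* Failure of [escape (2 * a)] at a single bound controls all laws of the ball at once. *)
have [B1 hB1] : exists B1, forall q, P q -> dist p q < eps -> 1 - cdf q B1 < 2 * a.
  move/existsNP: nea => [f hf]; exists f => q Pq pq.
  by rewrite ltNge; apply/negP => h; apply: hf; exists q.
pose B := maxn B0 B1.
have [K hK] : exists K, (1 - a) ^+ K <= 1 / 2 by apply: expr_small; rewrite a0.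
have [M hM] := bounded_on_words Pi B (n + K).
have M0 : 0 <= M by apply: le_trans (Pi_ge0 [::]) (hM _ _ _).
(* A loss above [f] exceeds the capital together with all premiums that can be collected before
   it. *)
pose f := maxn B (Num.truncn (Pi0 + (n + K).+1%:R * M)).+1.
have [q [Pq [pq aq]]] := ea f; have dq := HP _ Pq.
have bk s t : size s = n -> size t = K -> S B0 s -> first_exit B f t ->
    bankrupt_by Pi0 tau Pi (n + K) (s ++ t).
  move=> sn tK /andP[ts sB] /first_exitP[j [jt tB fj]].
  have jK : (n + j <= n + K)%N by rewrite leq_add2l -tK ltnW.
  have tk : take (n + j) (s ++ t) = s ++ take j t.
    by rewrite take_cat sn ltnNge leq_addr/= addKn.
  exists (n + j).+1; split; first by rewrite /= -addnS leq_add2l -tK.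
  apply: (@capital_lt0 _ M _ _ _ _ B f) => //.
  - by move=> u uN; apply: hM; exact: leq_trans jK.
  - rewrite tk all_cat tB andbT; apply: sub_all sB => x xB.
    by rewrite (leq_trans xB)// leq_maxl.
  - by rewrite tk stopped_cat.
  - by rewrite nth_cat sn [(n + j < n)%N]ltnNge leq_addr/= addKn.
  - apply: (@le_trans _ _ (Pi0 + (n + K).+1%:R * M)).
      by rewrite lerD2l ler_wpM2r// ler_nat ltnS.
    apply: le_trans (ltW (truncnS_gt _)) _.
    by rewrite ler_nat leq_maxr.
have qS : ((1 / 4)%:E <= expect q n (fun s => ind (S B0 s)))%E.
  have hl x : (x <= B0)%N -> l * p x <= q x by exact: heps.
  apply: le_trans (@expect_domination R p q l B0 n (fun s => ind (S B0 s)) dp.1 dq.1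
    (proj1 (andP l01)) hl _ _).
  - apply: (@le_trans _ _ ((1 / 2)%:E * (1 / 2)%:E)%E).
      by rewrite -EFinM lee_fin; lra.
    by apply: lee_pmul; rewrite ?lee_fin//; lra.
  - by move=> s; exact: ind_ge0.
  - by move=> s /negP h; rewrite indF// => /andP[].
have qW : ((1 / 4)%:E <= expect q K (fun t => ind (first_exit B f t)))%E.
  apply: le_trans (expect_first_exit dq K (a := a) (leq_maxl _ _) _ aq _).
  - by rewrite lee_fin; lra.
  - by rewrite (ltW a0).
  - have := hB1 _ Pq pq; have := le_cdf dq (leq_maxr B0 B1); rewrite -/B; lra.
have : (prob_n q (n + K) (bankrupt_by Pi0 tau Pi (n + K)) < (1 / 32)%:E)%E.
  apply: le_lt_trans (bank q Pq); apply: ereal_sup_ubound.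
  by exists (n + K)%N.
rewrite prob_nE; last exact: dq.1.
rewrite expect_cat ltNge => /negP; apply.
(* Entry concerns the first [n] letters and the exit the next [K], so by independence their
   probabilities multiply. *)
apply: (@le_trans _ _ (expect q n (fun s => (1 / 4)%:E * ind (S B0 s))%E)).
  rewrite (expectZ dq.1) => [||s]; [|lra|exact: ind_ge0].
  apply: (@le_trans _ _ ((1 / 4)%:E * (1 / 4)%:E)%E).
    by rewrite -EFinM lee_fin; lra.
  by apply: lee_pmul => //; rewrite lee_fin; lra.
apply: (le_expect dq.1) => [s|s sn].
  by rewrite mule_ge0 ?ind_ge0// lee_fin; lra.
case: (pselect (S B0 s)) => hS; last first.
  rewrite indF// mule0.
  by apply: (expect_ge0 dq.1) => t; exact: ind_ge0.
rewrite indT// mule1; apply: le_trans qW _.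
apply: (le_expect dq.1) => [t|t tK]; first exact: ind_ge0.
by apply: le_ind; exact: bk.
Qed.

End Necessity.

(** * Insuring without deceptive laws *)

Section Sufficiency.
Context {R : realType}.

Lemma ind_exists_le (r : seq nat) (A : nat -> Prop) :
  (@ind R (exists2 i, i \in r & A i) <= \sum_(i <- r) ind (A i))%E.
Proof.
elim: r => [|j r IH]; first by rewrite big_nil indF// => -[].
rewrite big_cons; case: (pselect (A j)) => Aj.
  apply: (le_trans (ind_le1 _)); rewrite (indT Aj) leeDl// sume_ge0// => i _.
  exact: ind_ge0.
rewrite (indF Aj) add0e; apply: le_trans IH; apply: le_ind => -[i].
by rewrite inE => /predU1P[->//|ir Ai]; exists i.
Qed.

Definition emp (s : seq nat) (x : nat) : R := (count_mem x s)%:R / (size s)%:R.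

(** The same [k] sets the range of symbols and the tolerance, as [dist_lt_of_close] requires. *)
Definition far k (q : nat -> R) s :=
  exists2 x, x \in index_iota 0 k.+1 & k.+1%:R^-1 <= `|emp s x - q x|.

(** Chebyshev's inequality costs [k.+1 ^ 2 / n] for each of [k.+1] symbols. The bound does not
    depend on [q], so test times can be fixed in advance. *)
Lemma expect_far (q : nat -> R) k n : is_distr q -> (0 < n)%N ->
  (expect q n (fun s => ind (far k q s)) <= (k.+1%:R ^+ 3 / n%:R)%:E)%E.
Proof.
move=> dq n0; have n0' : 0 < n%:R :> R by rewrite ltr0n.
have k0 : 0 < k.+1%:R :> R by rewrite ltr0n.
apply: (@le_trans _ _ (expect q n (fun s => \sum_(x <- index_iota 0 k.+1)
   ind (k.+1%:R^-1 <= `|(count_mem x s)%:R / n%:R - q x|)%R)%E)).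
  apply: (le_expect dq.1) => [s|s <-]; first exact: ind_ge0.
  exact: ind_exists_le.
rewrite (expect_sum dq.1); last by move=> *; exact: ind_ge0.
have k0' : 0 < k.+1%:R^-1 :> R by rewrite invr_gt0.
apply: (le_trans (lee_sum _ (fun x _ => chebyshev_count dq x n0 k0'))).
rewrite sumEFin big_const_seq count_predT size_iota subn0 iter_addr_0 lee_fin.
rewrite -[leLHS]mulr_natl le_eqVlt; apply/orP; left; apply/eqP.
move: {k0'} (k.+1%:R : R) (n%:R : R) k0 n0' => K m K0 m0.
by field; rewrite !gt_eqF.
Qed.

Lemma sum_geometric_le (eta : R) m : 0 < eta ->
  \sum_(0 <= k < m) eta / 2 ^+ (k + 3) <= eta / 4.
Proof.
move=> eta0; suff -> : \sum_(0 <= k < m) eta / 2 ^+ (k + 3) = eta / 4 * (1 - 2 ^- m).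
  by rewrite ler_piMr ?divr_ge0 ?(ltW eta0)// gerBl invr_ge0 exprn_ge0.
elim: m => [|m IH]; first by rewrite big_nil expr0 invr1 subrr mulr0.
rewrite big_nat_recr//= IH exprD (exprS _ m); field.
by rewrite expf_neq0.
Qed.

Variable P : set (nat -> R).
Hypothesis HP : forall p, P p -> is_distr p.

Definition near_emp k (s : seq nat) : set (nat -> R) :=
  [set q | P q /\ ~ far k q s].

(** By the triangle inequality through the empirical law, the laws of [near_emp k s] are within
    [2 / k.+1] of [p] on the symbols up to [k], hence in the tight ball around [p]. *)
Lemma tight_near_emp p : P p -> ~ deceptive P p ->
  exists k0, forall k s, (k0 <= k)%N -> ~ far k p s -> tight (near_emp k s).
Proof.
move=> Pp nd; have dp := HP Pp.
have [eps eps0 te] := not_deceptive_tight HP nd.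
have [k0 hk] := dist_lt_of_close dp eps0; exists k0 => k s kk nf.
apply: sub_tight te => q [Pq nq]; split => //.
have close r : ~ far k r s -> forall x, (x <= k)%N -> `|emp s x - r x| <= k.+1%:R^-1.
  move=> nr x xk; rewrite leNgt; apply/negP => h; apply: nr; exists x; last exact: ltW.
  by rewrite mem_index_iota ltnS.
apply: (hk _ _ kk (HP Pq)) => x xk.
have := close _ nf x xk; have := close _ nq x xk.
move: k.+1%:R^-1 => c.
by rewrite !ler_norml => /andP[? ?] /andP[? ?]; apply/andP; split; lra.
Qed.

Lemma capital_ge (Pi0 : R) (tau : seq nat -> bool) Pi s m :
  (forall i, (i < m)%N -> tau (take i s) -> (nth 0%N s i)%:R <= Pi (take i s)) ->
  Pi0 <= capital Pi0 tau Pi s m.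
Proof.
move=> h; rewrite /capital lerDl sumr_ge0// => i _.
by case: (boolP (tau _)) => [/h|_]; rewrite ?mulr0// mulr1 subr_ge0; apply.
Qed.

(** Given the first [i] letters, [N] is fixed and the next letter still has law [q], so it exceeds a
    quantile of level [d] with probability at most [d]. *)
Lemma expect_next_gt (q : nat -> R) i n (C : seq nat -> Prop) (N : seq nat -> nat) (d : R) :
  is_distr q -> (i < n)%N -> 0 <= d ->
  (expect q n (fun s => ind [/\ C (take i s), (1 - cdf q (N (take i s)) <= d)%R &
     (N (take i s) < nth 0 s i)%N]) <= d%:E)%E.
Proof.
move=> dq ilt d0; have -> : n = (i + (n - i.+1).+1)%N by rewrite addnS -addSn subnKC.
rewrite expect_cat -[leRHS](expect_cst dq i).
apply: (le_expect dq.1) => [s|s si]; first by apply: (expect_ge0 dq.1) => t; exact: ind_ge0.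
move: (n - i.+1)%N => m.
have [hd|hd] := leP (1 - cdf q (N s)) d; last first.
  rewrite (@eq_expect _ _ _ _ (fun=> 0%E)) ?expect0// => t _.
  rewrite take_cat si ltnn subnn take0 cats0 indF// => -[_ h _].
  by move: hd; rewrite ltNge h.
apply: (@le_trans _ _ (expect q m.+1 (fun t => ind (N s < nth 0 t 0)%N))).
  apply: (le_expect dq.1) => [t|t _]; first exact: ind_ge0.
  apply: le_ind; rewrite take_cat si ltnn subnn take0 cats0 => -[_ _].
  by rewrite nth_cat si ltnn subnn.
apply: (@le_trans _ _ (\sum_(x <oo) (q x)%:E * (if (x <= N s)%N then 0 else 1)%:E)%E).
  apply: lee_nneseries => [x _ _|x _].
    by rewrite mule_ge0 ?lee_fin ?dq.1//; apply: (expect_ge0 dq.1) => t; exact: ind_ge0.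
  rewrite lee_wpmul2l ?lee_fin ?dq.1//= -[leRHS](expect_cst dq m).
  apply: (le_expect dq.1) => [t|t _]; first exact: ind_ge0.
  by rewrite [(x <= N s)%N]leqNgt; case: (N s < x)%N; [rewrite indT|rewrite indF].
by rewrite (mean_le dq) lee_fin mulr0 add0r mulr1.
Qed.

Lemma not_deceptive_insurable (Pi0 : R) : 0 <= Pi0 ->
  (forall p, P p -> ~ deceptive P p) -> insurable P Pi0.
Proof.
move=> Pi00 nd eta eta0.
(* These levels sum to at most [eta / 4]; they are spent once on misleading tests and once on losses
   above the premium. *)
pose dl (k : nat) : R := eta / 2 ^+ (k + 3).
have dl0 k : 0 < dl k by rewrite divr_gt0// exprn_gt0.
(* The bound [k <= T k] ensures that entry before time [n] can only come from a test with index
   below [n]. *)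
have /choice[T hT] (k : nat) : exists n, [/\ (k <= n)%N, (0 < n)%N &
    forall q, is_distr q -> (expect q n (fun s => ind (far k q s)) <= (dl k)%:E)%E].
  exists (k + (Num.truncn (k.+1%:R ^+ 3 / dl k)).+1)%N; split => [||q dq].
  - exact: leq_addr.
  - by rewrite addnS.
  - apply: le_trans (expect_far k dq _) _; first by rewrite addnS.
    rewrite lee_fin ler_pdivrMr ?addnS ?ltr0n// mulrC -ler_pdivrMr//.
    apply: ltW; apply: lt_le_trans (truncnS_gt _) _.
    by rewrite ler_nat ltnS leq_addl.
(* The test reads only the first [T k] letters, so its outcome persists and [tau] is monotone. *)
pose ready s k := (T k <= size s)%N /\ tight (near_emp k (take (T k) s)).
pose tau s := `[< exists k, ready s k >].
(* The premium is a quantile common to the laws left by the passed test; its level depends on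
   [size s] to make the risks summable over time. *)
have /choice[N hN] s : exists N, tau s -> exists2 k, (T k <= size s)%N &
    forall q, near_emp k (take (T k) s) q -> 1 - cdf q N <= dl (size s).
  have [[k [Tk tk]]|nt] := pselect (exists k, ready s k); last first.
    by exists 0%N => /asboolP.
  by have [N hN] := tk _ (dl0 (size s)); exists N => _; exists k.
pose Pi s : R := if tau s then (N s)%:R else 0.
exists tau, Pi; split; first (split; last (split; last split)).
- move=> s x /asboolP[k [Tk tk]]; apply/asboolP; exists k; split.
    by rewrite size_rcons (leq_trans Tk).
  by rewrite -cats1 takel_cat.
- move=> p Pp; have dp := HP Pp; have [k0 hk0] := tight_near_emp Pp (nd _ Pp).
  apply/eqP; rewrite eq_le; apply/andP; split.
    apply: ge_ereal_sup => _ [n _ <-]; rewrite prob_nE; last exact: dp.1.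
    rewrite -[leRHS](expect_cst dp n).
    apply: (le_expect dp.1) => [s|s _]; first exact: ind_ge0.
    exact: ind_le1.
  apply/lee_addgt0Pr => e e0.
  (* From [k0] on, the test is passed unless [p] is far from the empirical law, and
     [2 ^+ (k + 3) >= k > eta / e] makes that event have probability at most [e]. *)
  pose k := maxn k0 (Num.truncn (eta / e)).+1.
  have ke : dl k <= e.
    rewrite ler_pdivrMr ?exprn_gt0// mulrC -ler_pdivrMr//.
    apply: ltW; apply: lt_le_trans (truncnS_gt _) _.
    apply: (@le_trans _ _ k%:R); first by rewrite ler_nat leq_maxr.
    by rewrite -natrX ler_nat (leq_trans (ltnW (ltn_expl k (ltnSn 1))))// leq_exp2l// leq_addr.
  have [_ T0 hTk] := hT k.
  apply: (@le_trans _ _ (expect p (T k) (fun s => ind (tau s)) + (dl k)%:E)%E); last first.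
    rewrite leeD ?lee_fin//; apply: ereal_sup_ubound; exists (T k) => //.
    by rewrite prob_nE//; exact: dp.1.
  apply: (@le_trans _ _ (expect p (T k) (fun s => ind (tau s)) +
     expect p (T k) (fun s => ind (far k p s)))%E); last by rewrite leeD2l ?hTk.
  rewrite -(expectD dp.1) => [|s|s]; [|exact: ind_ge0|exact: ind_ge0].
  rewrite -[leLHS](expect_cst dp (T k)).
  apply: (le_expect dp.1) => [s|s sT]; first by rewrite lee_fin.
  have [fs|nf] := pselect (far k p s); first by rewrite (indT fs) leeDr ?ind_ge0.
  rewrite (@indT _ (tau s)) ?leeDl ?ind_ge0//; apply/asboolP; exists k.
  split; first by rewrite sT.
  by rewrite -sT take_size; apply: hk0 => //; exact: leq_maxl.
- by move=> s; rewrite /Pi; case: ifP.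
- by move=> s /negbTE ts; rewrite /Pi ts.
move=> q Pq; have dq := HP Pq.
apply: (@le_lt_trans _ _ (eta / 4 + eta / 4)%:E); last by rewrite lte_fin; lra.
apply: ge_ereal_sup => _ [n _ <-]; rewrite prob_nE; last exact: dq.1.
pose bad i s := [/\ tau (take i s), (1 - cdf q (N (take i s)) <= dl i)%R &
     (N (take i s) < nth 0 s i)%N].
pose miss k s := (T k <= n)%N /\ far k q (take (T k) s).
(* Ruin needs a loss above its premium. Either the test behind the entry had excluded the true law,
   or that premium was a genuine quantile of it. *)
have key s : size s = n -> bankrupt_by Pi0 tau Pi n s ->
    (exists2 k, k \in index_iota 0 n & miss k s) \/
    (exists2 i, i \in index_iota 0 n & bad i s).
  move=> sn [m [/andP[m0 mn] cap]].
  have [i im [ti Ni]] : exists2 i, (i < m)%N &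
      tau (take i s) /\ (N (take i s) < nth 0 s i)%N.
    apply: contrapT => ne; move: cap; rewrite ltNge => /negP; apply.
    apply: le_trans Pi00 _; apply: capital_ge => i im ti.
    rewrite /Pi ti ler_nat leqNgt; apply/negP => h; apply: ne.
    by exists i.
  have si : size (take i s) = i by rewrite size_takel// sn (leq_trans (ltnW im)).
  have [k Tk hk] := hN _ ti; rewrite si in Tk hk.
  have kn : (k < n)%N.
    by have [kT _ _] := hT k; apply: leq_ltn_trans (leq_trans kT Tk) (leq_trans im mn).
  rewrite take_takel// in hk.
  have [fk|nf] := pselect (far k q (take (T k) s)); [left; exists k|right; exists i] => //.
  - by rewrite mem_index_iota.
  - by split => //; rewrite (leq_trans Tk)// ltnW// (leq_trans im).
  - by rewrite mem_index_iota (leq_trans im).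
  - by split => //; apply: hk.
apply: (@le_trans _ _ (expect q n (fun s => \sum_(k <- index_iota 0 n) ind (miss k s) +
    \sum_(i <- index_iota 0 n) ind (bad i s))%E)).
  apply: (le_expect dq.1) => [s|s sn]; first exact: ind_ge0.
  apply: le_trans (leeD (ind_exists_le _ _) (ind_exists_le _ _)).
  have [b|nb] := pselect (bankrupt_by Pi0 tau Pi n s); last first.
    by rewrite indF// adde_ge0 ?ind_ge0.
  rewrite indT//; case: (key s sn b) => h.
    by rewrite (indT h) leeDl ?ind_ge0.
  by rewrite (indT h) leeDr ?ind_ge0.
rewrite (expectD dq.1); last 2 first.
- by move=> s; apply: sume_ge0 => i _; exact: ind_ge0.
- by move=> s; apply: sume_ge0 => i _; exact: ind_ge0.
rewrite !(expect_sum dq.1); [|by move=> *; exact: ind_ge0..].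
rewrite EFinD; apply: leeD.
- apply: (@le_trans _ _ (\sum_(0 <= k < n) dl k)%:E); last by rewrite lee_fin sum_geometric_le.
  rewrite -sumEFin; apply: lee_sum => k _.
  (* A test scheduled after time [n] contributes nothing. *)
  have [Tn|nT] := leqP (T k) n; last first.
    rewrite (@eq_expect _ _ _ _ (fun=> 0%E)) ?expect0 ?lee_fin ?(ltW (dl0 k))// => s _.
    by rewrite indF// => -[]; rewrite leqNgt nT.
  have [_ _ /(_ q dq)] := hT k; apply: le_trans.
  rewrite -(expect_take dq _ Tn); apply: (le_expect dq.1) => [s|s _]; first exact: ind_ge0.
  by apply: le_ind => -[].
- apply: (@le_trans _ _ (\sum_(0 <= i < n) dl i)%:E); last by rewrite lee_fin sum_geometric_le.
  rewrite -sumEFin big_nat [leRHS]big_nat; apply: lee_sum => i /andP[_ ilt].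
  exact: (@expect_next_gt q i n (fun s => tau s) N (dl i) dq ilt (ltW (dl0 i))).
Qed.

End Sufficiency.

Theorem theorem1 (R : realType) (P : set (nat -> R))
    (HP : forall p, P p -> is_distr p) (Pi0 : R) (HPi0 : 0 <= Pi0) :
  insurable P Pi0 <-> (forall p, P p -> ~ deceptive P p).
Proof.
split=> [ins p Pp|nd]; first exact: insurable_not_deceptive ins Pp.
exact: not_deceptive_insurable.
Qed.
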